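(* Let $\Omega=(a,b)$ with real numbers $a<b$. For all grid sizes $h$ and each $p\in\mathbb{N}$, the inequality $$|u_{p,h}|_{H^1(\Omega)}\le 2\sqrt{3}\,h^{-1}\,\|u_{p,h}\|_{L^2(\Omega)}$$ is satisfied for all $u_{p,h}\in\widetilde{S}_{p,h}(\Omega)$.
   Context: $\mathbb{N}=\{1,2,3,\ldots\}$, $\mathbb{N}_0=\mathbb{N}\cup\{0\}$. A grid size for $\Omega=(a,b)$ is a real $h>0$ such that $n_h:=h^{-1}(b-a)\in\mathbb{N}$. $H^r(\Omega)$ is the standard Sobolev space ($H^0=L^2$) and $|u|_{H^r(\Omega)}:=\|\frac{\partial^r}{\partial x^r}u\|_{L^2(\Omega)}$. $\mathbb{P}^p$ is the space of polynomials of degree at most $p$, and $$S_{p,h}(\Omega):=\{u\in H^p(\Omega): u|_{(a+hj,a+h(j+1)]}\in\mathbb{P}^p\text{ for all }j=0,\ldots,n_h-1\}.$$ The space of splines with vanishing odd derivatives, $\widetilde{S}_{p,h}(\Omega)$, is the space of all $u_{p,h}\in S_{p,h}(\Omega)$ satisfying $$\frac{\partial^{2l+1}}{\partial x^{2l+1}}u_{p,h}(a)=\frac{\partial^{2l+1}}{\partial x^{2l+1}}u_{p,h}(b)=0\quad\text{for all }l\in\mathbb{N}_0\text{ with }2l+1<p.$$ *)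

(* Defs.v *)
From HB Require Import structures.
From mathcomp Require Import all_boot all_order all_algebra.
From mathcomp Require Import all_classical all_reals all_analysis.

Set Implicit Arguments.
Unset Strict Implicit.
Unset Printing Implicit Defensive.
Import Order.TTheory GRing.Theory Num.Theory.
Import numFieldNormedType.Exports.
Local Open Scope classical_set_scope.
Local Open Scope ring_scope.

(* An element of a space of functions on ]a, b[ is
   represented by a total function R -> R; its values outside ]a, b[, and on
   null sets, are irrelevant to all the notions below. *)

Definition test_function {R : realType} (a b : R) : set (R -> R) :=
  [set phi | [/\ forall (n : nat) (x : R), derivable (derive1n n phi) x 1,
                 compact (closure [set x | phi x != 0]) &
                 closure [set x | phi x != 0] `<=` `]a, b[ ]].

Definition weak_derivative {R : realType} (a b : R) (k : nat)
    (u v : R -> R) : Prop :=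
  [/\ locally_integrable `]a, b[ u, locally_integrable `]a, b[ v &
      forall phi, test_function a b phi ->
        (\int[lebesgue_measure]_(x in `]a, b[) (u x * derive1n k phi x)%:E =
         ((-1) ^+ k)%:E *
         \int[lebesgue_measure]_(x in `]a, b[) (v x * phi x)%:E)%E].

(* A representative of the (a.e. unique) weak derivative of order k; it is 0 by
   convention when there is none. *)
Definition wderiv {R : realType} (a b : R) (k : nat) (u : R -> R) : R -> R :=
  xget (fun=> 0) [set v | weak_derivative a b k u v].

(* The restriction of u to ]a, b[, extended by 0. *)
Definition restr {R : realType} (a b : R) (u : R -> R) : R -> R :=
  u \_ `]a, b[.

Definition L2 {R : realType} (a b : R) : set (R -> R) :=
  [set u | restr a b u \in Lfun lebesgue_measure 2%:E].

Definition L2norm {R : realType} (a b : R) (u : R -> R) : \bar R :=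
  'N[lebesgue_measure]_(2%:E)[EFin \o restr a b u].

Definition Hspace {R : realType} (a b : R) (r : nat) : set (R -> R) :=
  [set u | L2 a b u /\
     forall k : nat, (0 < k <= r)%N ->
       exists2 v, weak_derivative a b k u v & L2 a b v].

Definition Hseminorm {R : realType} (a b : R) (r : nat) (u : R -> R) : \bar R :=
  L2norm a b (wderiv a b r u).

Definition grid_size {R : realType} (a b h : R) : Prop :=
  0 < h /\ exists2 n : nat, (0 < n)%N & h^-1 * (b - a) = n%:R.

(* The truncation is exact when grid_size a b h holds. *)
Definition ncells {R : realType} (a b h : R) : nat :=
  Num.truncn (h^-1 * (b - a)).

(* Being polynomial on a cell is required a.e. because u stands for its class
   in H^p; one can always modify u on a null set so that equality holds
   everywhere on each half-open cell. *)
Definition spline {R : realType} (a b : R) (p : nat) (h : R) : set (R -> R) :=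
  [set u | Hspace a b p u /\
     forall j : nat, (j < ncells a b h)%N ->
       exists2 q : {poly R}, (size q <= p.+1)%N &
         {ae lebesgue_measure, forall x,
           x \in `]a + h * j%:R, a + h * (j.+1)%:R] -> u x = q.[x]}].

(* c is the value at the point x of [a, b] of the continuous representative on
   [a, b] of f.  A weak derivative of order k < p of a function of H^p lies in
   H^1 and hence has such a representative, which is unique. *)
Definition trace {R : realType} (a b : R) (f : R -> R) (x c : R) : Prop :=
  exists g : R -> R, [/\ {within `[a, b], continuous g},
    {ae lebesgue_measure, forall y, y \in `]a, b[ -> f y = g y} & g x = c].

Definition spline_odd {R : realType} (a b : R) (p : nat) (h : R) :
    set (R -> R) :=
  [set u | spline a b p h u /\
     forall l : nat, (l.*2.+1 < p)%N ->
       trace a b (wderiv a b l.*2.+1 u) a 0 /\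
       trace a b (wderiv a b l.*2.+1 u) b 0].

(* Main.v *)
(** Write [A k] for the squared [L^2] norm of the [k]-th derivative of [u].  On
  each cell the derivative of order [p - 1] is linear, and an explicit
  computation gives [A p <= c A (p - 1)] with [c = 12 / h ^ 2].  Integrating by
  parts, [A (k + 1) = - <u^(k + 2), u^(k)>] for [k + 2 <= p]: the interior
  boundary terms cancel because the derivatives of order less than [p] are
  continuous, and those at [a] and [b] vanish because [k] or [k + 1] is odd.
  Expanding [0 <= || u^(k + 2) + c u^(k) ||^2], the bound
  [A (k + 2) <= c A (k + 1)] therefore yields [A (k + 1) <= c A k], and one
  descends to [k = 0].

  That a weak derivative is computed cell by cell, without jumps at the nodes,
  is obtained by testing against products of two functions of the form
  [exp (- 1 / (s x))], which tend to the indicator of an interval as [s] tends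
  to infinity. *)
Require Import Defs.
From HB Require Import structures.
From mathcomp Require Import all_boot all_order all_algebra.
From mathcomp Require Import all_classical all_reals all_analysis.
From mathcomp Require Import measurable_realfun zify ring lra.

Set Implicit Arguments.
Unset Strict Implicit.
Unset Printing Implicit Defensive.
Import Order.TTheory GRing.Theory Num.Theory.
Import numFieldNormedType.Exports.
Local Open Scope classical_set_scope.
Local Open Scope ring_scope.

(** * Integrals of polynomials and the inverse inequality on one cell *)

Section PolynomialIntegral.
Context {R : realType}.
Notation mu := (@lebesgue_measure R).
Implicit Types (p q r : {poly R}) (a b c h : R).

Lemma continuous_horner p : continuous (horner p).
Proof.
move=> x; apply/differentiable_continuous/derivable1_diffP.
exact: derivable_horner.
Qed.

Lemma continuous_integrable_itv (f : R -> R) a b : continuous f ->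
  mu.-integrable `[a, b] (EFin \o f).
Proof.
move=> cf; apply: continuous_compact_integrable; first exact: segment_compact.
exact: continuous_subspaceT.
Qed.

Definition pint a b p : R := \int[mu]_(x in `[a, b]) p.[x].

Lemma integrable_horner p a b :
  mu.-integrable `[a, b] (EFin \o (fun x => p.[x])).
Proof. exact/continuous_integrable_itv/continuous_horner. Qed.

Lemma pintD a b p q : pint a b (p + q) = pint a b p + pint a b q.
Proof.
rewrite /pint; under eq_Rintegral do rewrite hornerD.
by rewrite RintegralD//; exact: integrable_horner.
Qed.

Lemma pintZ a b c p : pint a b (c *: p) = c * pint a b p.
Proof.
rewrite /pint; under eq_Rintegral do rewrite hornerZ.
by rewrite RintegralZl//; exact: integrable_horner.
Qed.

Lemma pint_sqr_ge0 a b p : 0 <= pint a b (p * p).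
Proof. by apply: Rintegral_ge0 => x _; rewrite hornerM -expr2 sqr_ge0. Qed.

Lemma integral_pint a b p :
  (\int[mu]_(x in `[a, b]) (p.[x])%:E)%E = (pint a b p)%:E.
Proof.
rewrite /pint /Rintegral fineK//; apply: integrable_fin_num => //.
exact: integrable_horner.
Qed.

Lemma pint_deriv a b p : a < b -> pint a b p^`()%R = p.[b] - p.[a].
Proof.
move=> ab; apply: EFin_inj; rewrite -integral_pint EFinB.
apply: (@continuous_FTC2 R (horner p^`()%R) (horner p)) => //.
- exact/continuous_subspaceT/continuous_horner.
- split.
  + by move=> x _; exact: derivable_horner.
  + exact/cvg_at_right_filter/continuous_horner.
  + exact/cvg_at_left_filter/continuous_horner.
- by move=> x _; rewrite -derivE.
Qed.

Lemma pint_by_parts a b p q : a < b ->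
  pint a b (p^`()%R * q) = p.[b] * q.[b] - p.[a] * q.[a] - pint a b (p * q^`()%R).
Proof.
move=> ab; have := pint_deriv (p * q) ab.
by rewrite derivM pintD !hornerM => <-; rewrite addrK.
Qed.

(* Equality holds for a linear [q] vanishing at the midpoint of the cell. *)
Lemma linear_inverse_inequality a h q : 0 < h -> (size q <= 2)%N ->
  pint a (a + h) (q^`()%R * q^`()%R) <= 12 * h^-1 ^+ 2 * pint a (a + h) (q * q).
Proof.
move=> h0 sq; set b := a + h; have ab : a < b by rewrite ltrDl.
pose v := q`_0; pose s := q`_1.
have qE : q = v%:P + s *: 'X.
  apply/polyP => -[|[|i]]; rewrite coefD coefC coefZ coefX/=;
    rewrite ?mulr0 ?mulr1 ?addr0 ?add0r//.
  by apply/nth_default/(leq_trans sq).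
have dq : q^`()%R = s%:P by rewrite qE derivD derivC derivZ derivX add0r alg_polyC.
(* With a third of the slope as a parameter, the antiderivative [P] of [q * q] is written without
   division, so that [ring] applies to polynomials. *)
pose w := s / 3; have s3 : s = 3 * w by rewrite /w mulrC divfK ?pnatr_eq0.
pose P := v ^+ 2 *: 'X + (v * s) *: 'X^2 + (w * s) *: 'X^3.
have dP : P^`()%R = q * q.
  rewrite /P !derivD !derivZ derivX !derivXn qE -!mul_polyC s3 /=.
  by rewrite !(polyCM, polyC_exp, polyC_natr); ring.
have qq : pint a b (q * q) = P.[b] - P.[a] by rewrite -dP pint_deriv.
have dqq : pint a b (q^`()%R * q^`()%R) = s ^+ 2 * h.
  have -> : q^`()%R * q^`()%R = (s ^+ 2 *: 'X)^`()%R.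
    by rewrite dq derivZ derivX alg_polyC -polyCM expr2.
  by rewrite pint_deriv// !hornerZ !hornerX /b; ring.
rewrite dqq qq /P !(hornerD, hornerZ, hornerXn, hornerX) -subr_ge0 /b s3.
set d := (X in 0 <= X).
(* The quantity squared is twice the value of [q] at the midpoint [a + h / 2]. *)
suff -> : d = 3 * h^-1 * (2 * v + s * (2 * a + h)) ^+ 2.
  by rewrite mulr_ge0 ?sqr_ge0// mulr_ge0// invr_ge0 ltW.
by rewrite /d s3; field; rewrite gt_eqF.
Qed.

End PolynomialIntegral.

(** * Piecewise polynomials and the descent on the order of the derivative *)

Section BrokenInverseInequality.
Context {R : realType}.
Variables (n : nat) (t : nat -> R) (Q : nat -> {poly R}).
Hypothesis t_incr : forall j, t j < t j.+1.
Implicit Types (f g : nat -> {poly R}).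

(** The $L^2$ inner product of two piecewise polynomials, cell [j] running from [t j] to
    [t j.+1]. *)
Definition broken f g : R := \sum_(j < n) pint (t j) (t j.+1) (f j * g j).

Lemma broken_sqr_ge0 f : 0 <= broken f f.
Proof. by apply: sumr_ge0 => j _; exact: pint_sqr_ge0. Qed.

Lemma broken_sqrD f g (c : R) :
  broken (fun j => f j + c *: g j) (fun j => f j + c *: g j) =
  broken f f + 2 * c * broken f g + c ^+ 2 * broken g g.
Proof.
rewrite /broken !mulr_sumr -!big_split/=; apply: eq_bigr => j _.
have -> : (f j + c *: g j) * (f j + c *: g j) =
    f j * f j + (2 * c) *: (f j * g j) + c ^+ 2 *: (g j * g j).
  by rewrite -!mul_polyC !(polyCM, polyC_exp, polyC_natr); ring.
by rewrite !pintD !pintZ.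
Qed.

Let D k j := derivn k (Q j).

(** Integrating by parts on each cell, the boundary terms at the interior nodes agree from both
    sides and telescope; at each end one of the two factors vanishes. *)
Lemma broken_by_parts k : (0 < n)%N ->
  (forall j, (j.+1 < n)%N -> forall i, (i <= k.+1)%N ->
    (D i j).[t j.+1] = (D i j.+1).[t j.+1]) ->
  (D k 0).[t 0] = 0 \/ (D k.+1 0).[t 0] = 0 ->
  (D k n.-1).[t n] = 0 \/ (D k.+1 n.-1).[t n] = 0 ->
  broken (D k.+2) (D k) = - broken (D k.+1) (D k.+1).
Proof.
move=> n0 glue left0 right0.
pose B j := (D k.+1 j).[t j] * (D k j).[t j].
pose C := (D k.+1 n.-1).[t n] * (D k n.-1).[t n].
(* The boundary term at node [j], read from the cell on its right; the last node has no such cell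
   and is read from cell [n.-1]. *)
pose B' j := if (j < n)%N then B j else C.
have B0 : B' 0 = 0.
  by rewrite /B' n0 /B; case: left0 => ->; rewrite ?mulr0 ?mul0r.
have Bn : B' n = 0.
  by rewrite /B' ltnn /C; case: right0 => ->; rewrite ?mulr0 ?mul0r.
suff : broken (D k.+2) (D k) + broken (D k.+1) (D k.+1) = B' n - B' 0.
  by rewrite B0 Bn subrr => /eqP; rewrite addr_eq0 => /eqP.
rewrite -telescope_sumr// big_mkord /broken -big_split/=; apply: eq_bigr => j _.
have DS i : D i.+1 j = (D i j)^`()%R by [].
rewrite -!DS pint_by_parts// -DS subrK; congr (_ - _).
  rewrite /B'; case: ltnP => [jn|nj]; first by rewrite /B !glue.
  have nE : n = j.+1 by apply/eqP; rewrite eqn_leq nj ltn_ord.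
  rewrite /C; have [-> ->] : n.-1 = j /\ t n = t j.+1 by split; [lia|congr t].
  by [].
by rewrite /B' ltn_ord.
Qed.

Lemma broken_inverse_inequality (h : R) p : 0 < h -> (0 < n)%N -> (0 < p)%N ->
  (forall j, t j.+1 = t j + h) ->
  (forall j, (j < n)%N -> (size (Q j) <= p.+1)%N) ->
  (forall k j, (k < p)%N -> (j.+1 < n)%N ->
    (D k j).[t j.+1] = (D k j.+1).[t j.+1]) ->
  (forall k, (k < p)%N -> odd k ->
    (D k 0).[t 0] = 0 /\ (D k n.-1).[t n] = 0) ->
  broken (D 1) (D 1) <= 12 * h^-1 ^+ 2 * broken (D 0) (D 0).
Proof.
move=> h0 n0 p0 tE sQ glue bd.
set c := 12 * h^-1 ^+ 2; have c0 : 0 < c by rewrite mulr_gt0// exprn_gt0 ?invr_gt0.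
(* Induction on [m] descends from order [p]; the claim is the case [m = p.-1]. *)
suff H m : (m < p)%N -> broken (D (p - m)) (D (p - m)) <=
    c * broken (D (p - m).-1) (D (p - m).-1).
  have := H p.-1; rewrite prednK// leqnn => /(_ isT).
  by have -> : (p - p.-1 = 1)%N by lia.
elim: m => [_|m IH mp].
  rewrite subn0 -(prednK p0) /broken mulr_sumr; apply: ler_sum => j _.
  rewrite tE; apply: linear_inverse_inequality => //.
  (* Differentiating a polynomial of degree at most [p] exactly [p.-1] times leaves degree at most
     1. *)
  apply/leq_sizeP => i i2; rewrite coef_derivn.
  by rewrite nth_default ?mul0rn//; apply/(leq_trans (sQ _ (ltn_ord j))); lia.
have {IH} := IH (ltnW mp).
have -> : (p - m = (p - m.+2).+2)%N by lia.
have -> : (p - m.+1 = (p - m.+2).+1)%N by lia.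
have : ((p - m.+2).+1 < p)%N by lia.
move: (p - m.+2)%N => k kp /= IH.
have parts : broken (D k.+2) (D k) = - broken (D k.+1) (D k.+1).
  apply: broken_by_parts => //.
  - by move=> j jn i ik; apply: glue => //; exact: leq_ltn_trans kp.
  (* One of [k] and [k.+1] is odd, and both are below [p]. *)
  - by case: (boolP (odd k)) => ok; [left|right]; apply bd => //=;
      rewrite ?ok //; exact: ltnW.
  - by case: (boolP (odd k)) => ok; [left|right]; apply bd => //=;
      rewrite ?ok //; exact: ltnW.
have := broken_sqr_ge0 (fun j => D k.+2 j + c *: D k j).
rewrite broken_sqrD parts => pos.
(* After multiplication by [c], both facts combine linearly: $c A_{k+1} \le 2 c A_{k+1} - A_{k+2}
   \le c^2 A_k$. *)
rewrite -(ler_pM2l c0).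
move: pos IH; set x := broken _ _; set y := broken _ _; set z := broken _ _.
by move=> pos IH; nra.
Qed.

End BrokenInverseInequality.

(** * Smooth functions flat at the origin, and bump functions *)

Section SmoothBump.
Context {R : realType}.
Implicit Types (P : {poly R}) (f g : R -> R) (a b c d s x : R).

(* The derivatives of [exp (- 1 / x)], extended by [0] to [x <= 0], are all of
   this form. *)
Definition flat P x : R := if 0 < x then P.[x^-1] * expR (- x^-1) else 0.

(** With $y = 1/x$, the Taylor bound $y^{i+2} \le (i+2)!\, e^y$ gives $y^i e^{-y} \le (i+2)!\, x^2$
    for each monomial. Quadratic decay is what differentiability at 0 requires below. *)
Lemma flat_bound P : exists2 C, 0 <= C & forall x, `|flat P x| <= C * x ^+ 2.
Proof.
exists (\sum_(i < size P) `|P`_i| * (i.+2)`!%:R) => [|x].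
  by apply: sumr_ge0 => i _; rewrite mulr_ge0.
rewrite /flat; case: ifPn => x0; last first.
  rewrite normr0 mulr_ge0 ?sqr_ge0//.
  by apply: sumr_ge0 => i _; rewrite mulr_ge0.
rewrite normrM (ger0_norm (expR_ge0 _)) horner_coef.
rewrite (le_trans (ler_wpM2r (expR_ge0 _) (ler_norm_sum _ _ _)))//.
rewrite !mulr_suml; apply: ler_sum => i _; rewrite normrM -!mulrA.
apply: ler_wpM2l => //; have y0 : 0 < x^-1 by rewrite invr_gt0.
rewrite normrX gtr0_norm// expRN ler_pdivrMr ?expR_gt0//.
have := expR_ge1Dxn i.+1 (ltW y0); set e := expR _ => he.
have he' : x^-1 ^+ i.+2 <= (i.+2)`!%:R * e.
  rewrite mulrC -ler_pdivrMr ?ltr0n ?fact_gt0//.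
  by apply: le_trans he; rewrite lerDr.
rewrite mulrAC -ler_pdivrMr ?exprn_gt0//.
by rewrite -exprVn -exprD addn2.
Qed.

(** Chain rule with $y = 1/x$: $(P(y) e^{-y})' = (P'(y) - P(y)) e^{-y} \cdot (-y^2)$. *)
Definition flat_deriv P : {poly R} := (P - P^`()%R) * 'X^2.

Lemma is_derive_flat P x : is_derive x 1 (flat P) (flat (flat_deriv P) x).
Proof.
have [x0|x0|->] := ltgtP x 0.
- rewrite [X in is_derive _ _ _ X]/flat ltNge (ltW x0)/=.
  apply: (@near_eq_is_derive _ _ _ (cst 0)).
  near=> y; rewrite /flat ifF//; apply/negbTE; rewrite -leNgt ltW//.
  by near: y; exact: lt_nbhsl.
- rewrite [X in is_derive _ _ _ X]/flat x0.
  have dV : is_derive x 1 (fun y : R => y^-1) (- x ^- 2 *: 1).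
    by apply: is_deriveV; rewrite gt_eqF.
  have dP := is_derive1_comp (is_derive_poly P x^-1) dV.
  have dE := @is_derive1_comp _ expR (- (fun y : R => y^-1)) x _ _
    (is_derive_expR (- x^-1)) (is_deriveN dV).
  have nearE : \near x, ((horner P \o (fun y : R => y^-1)) *
      (expR \o (- (fun y : R => y^-1)))) x = flat P x.
    near=> y; rewrite /flat ifT//.
    by near: y; exact: lt_nbhsr.
  have := near_eq_is_derive nearE (is_deriveM dP dE).
  set l := (X in is_derive _ _ _ X) => H.
  suff <- : l = (flat_deriv P).[x^-1] * expR (- x^-1) by [].
  rewrite /l /flat_deriv /comp hornerM hornerXn hornerD hornerN /GRing.scale.
  by rewrite /= -exprVn fctE; ring.
- rewrite [X in is_derive _ _ _ X]/flat ltxx.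
  (* At 0 the quadratic bound makes the difference quotient at most [C * |h|]. *)
  have [C C0 HC] := flat_bound P.
  have : (fun h => h^-1 *: (flat P (h *: 1 + 0) - flat P 0)) @ 0^' --> (0 : R).
    apply: norm_cvg0.
    apply: (@squeeze_cvgr _ _ _ _ (cst 0) (fun h => C * `|h|)).
    + near=> h; have h0 : h != 0 by near: h; exact: nbhs_dnbhs_neq.
      rewrite normr_ge0/= addr0 {2}/flat ltxx subr0 normrM normfV.
      rewrite ler_pdivrMl ?normr_gt0// (le_trans (HC _))//.
      by rewrite /GRing.scale/= mulr1 -[h ^+ 2]real_normK ?num_real//; lra.
    + exact: cvg_cst.
    + rewrite -[X in _ --> X](mulr0 C); apply: cvgMl_tmp.
      rewrite -[X in _ --> X](@normr0 _ R); apply: cvg_norm.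
      by apply: cvg_within_filter; exact: cvg_id.
  move=> H; apply: DeriveDef; first by apply/cvg_ex; exists 0.
  by apply: cvg_lim.
Unshelve. all: by end_near. Qed.

(** A class closed under differentiation, so that smoothness of all orders follows by induction with
    no formula for higher derivatives. *)
Inductive flat_algebra : (R -> R) -> Prop :=
| flat_algebra_affine P c d : flat_algebra (fun x => flat P (c * x + d))
| flat_algebraD f g : flat_algebra f -> flat_algebra g ->
    flat_algebra (f \+ g)
| flat_algebraM f g : flat_algebra f -> flat_algebra g ->
    flat_algebra (f \* g).

Lemma flat_algebra_derive f : flat_algebra f ->
  exists2 g, flat_algebra g & forall x, is_derive x 1 f (g x).
Proof.
elim=> [P c d|{}f g fA [f' f'A df] gA [g' g'A dg]|
  {}f g fA [f' f'A df] gA [g' g'A dg]].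
- exists (fun x => flat (c *: flat_deriv P) (c * x + d)) => [|x].
    exact: flat_algebra_affine.
  have -> : flat (c *: flat_deriv P) (c * x + d) =
      flat (flat_deriv P) (c * x + d) * c.
    by rewrite /flat; case: ifP => _; rewrite ?mul0r// hornerZ; ring.
  have dL : is_derive x 1 (c \*: (id : R -> R) + cst d) c.
    by apply: is_derive_eq; rewrite addr0 /GRing.scale/= mulr1.
  exact: (@is_derive1_comp _ (flat P) _ x _ _ (is_derive_flat P _) dL).
- by exists (f' \+ g') => [|x]; [exact: flat_algebraD|exact: is_deriveD].
- exists ((f \* g') \+ (g \* f')) => [|x]; last exact: is_deriveM.
  by apply: flat_algebraD; exact: flat_algebraM.
Qed.

Lemma flat_algebra_smooth f n x : flat_algebra f ->
  derivable (derive1n n f) x 1.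
Proof.
elim: n f => [|n IH] f fA; have [g gA fg] := flat_algebra_derive fA.
  exact/ex_derive.
rewrite derive1Sn; suff -> : derive1 f = g by exact: IH.
by apply/funext => y; rewrite derive1E; exact: derive_val.
Qed.

(** For positive [s] the first factor vanishes up to [a] and the second from [b] on; a larger [s]
    steepens both. *)
Definition smooth_bump a b s x : R := flat 1 (s * (x - a)) * flat 1 (s * (b - x)).

Lemma flat1_gt0 x : 0 < x -> flat 1 x = expR (- x^-1).
Proof. by move=> x0; rewrite /flat x0 hornerC mul1r. Qed.

Lemma flat_le0 P x : x <= 0 -> flat P x = 0.
Proof. by move=> x0; rewrite /flat ltNge x0. Qed.

Lemma flat1_ge0 x : 0 <= flat 1 x.
Proof.
by have [x0|x0] := ltP 0 x; [rewrite flat1_gt0 ?expR_ge0|rewrite flat_le0].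
Qed.

Lemma flat1_le1 x : flat 1 x <= 1.
Proof.
have [x0|x0] := ltP 0 x; last by rewrite flat_le0.
by rewrite flat1_gt0// expR_le1 oppr_le0 invr_ge0 ltW.
Qed.

Lemma bump_gt0 a b s x : 0 < s -> a < x < b -> 0 < smooth_bump a b s x.
Proof.
move=> s0 /andP[ax xb]; rewrite /smooth_bump !flat1_gt0 ?mulr_gt0 ?expR_gt0//.
all: by rewrite ?mulr_gt0// subr_gt0.
Qed.

Lemma bump_eq0 a b s x : 0 < s -> ~~ (a < x < b) -> smooth_bump a b s x = 0.
Proof.
move=> s0; rewrite negb_and -!leNgt => /orP[xa|bx].
  by rewrite /smooth_bump flat_le0 ?mul0r// pmulr_rle0// subr_le0.
by rewrite /smooth_bump mulrC flat_le0 ?mul0r// pmulr_rle0// subr_le0.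
Qed.

Lemma bump_norm_le1 a b s x : `|smooth_bump a b s x| <= 1.
Proof.
rewrite ger0_norm ?mulr_ge0 ?flat1_ge0//.
by rewrite -[leRHS]mulr1 ler_pM ?flat1_ge0 ?flat1_le1.
Qed.

(** The closed support lies in [[a, b]], hence is compact; the strict inequalities place it inside
    the open interval. *)
Lemma test_function_bump a b c d s : 0 < s -> c < a -> b < d ->
  test_function c d (smooth_bump a b s).
Proof.
move=> s0 ca bd.
have supp : closure [set x | smooth_bump a b s x != 0] `<=` `[a, b].
  rewrite (closure_id `[a, b]).1; last exact: itv_closed.
  apply: closureS => x /= /eqP bx; rewrite in_itv/=; apply/andP.
  have : a < x < b by apply: contrapT => /negP h; apply: bx; rewrite bump_eq0.
  by move=> /andP[/ltW ? /ltW ?].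
split.
- move=> n x; apply: flat_algebra_smooth.
  rewrite (_ : smooth_bump _ _ _ = (fun x => flat 1 (s * x + - (s * a))) \*
     (fun x => flat 1 ((- s) * x + s * b))).
    by apply: flat_algebraM; exact: flat_algebra_affine.
  by apply/funext => y /=; rewrite /smooth_bump; congr (flat _ _ * flat _ _); ring.
- exact: (subclosed_compact (@closed_closure _ _) (@segment_compact _ a b) supp).
- move=> x /supp /=; rewrite !in_itv/= => /andP[ax xb].
  by rewrite (lt_le_trans ca)// (le_lt_trans xb).
Qed.

Lemma flat1_cvg x : 0 < x -> flat 1 (n.+1%:R * x) @[n --> \oo] --> (1 : R).
Proof.
move=> x0; rewrite -[X in _ --> X]expR0.
rewrite [X in X @ _](_ : _ = fun n => expR (- (harmonic n * x^-1))); last first.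
  by apply/funext => n; rewrite flat1_gt0 ?mulr_gt0// invfM.
apply: continuous_cvg; first exact: continuous_expR.
rewrite -[X in _ --> X]oppr0 -[X in _ --> - X](mul0r x^-1).
by apply: cvgN; apply: cvgMr_tmp; exact: cvg_harmonic.
Qed.

Lemma bump_cvg a b x :
  smooth_bump a b n.+1%:R x @[n --> \oo] --> (if a < x < b then 1 else 0 : R).
Proof.
case: ifPn => xab.
  case/andP: xab => ax xb; rewrite -[X in _ --> X](mulr1 1).
  by apply: cvgM; apply: flat1_cvg; rewrite subr_gt0.
under eq_fun => n do rewrite bump_eq0//.
exact: cvg_cst.
Qed.

End SmoothBump.

(** * Test functions and their derivatives *)

Section TestFunctions.
Context {R : realType}.
Variables (a b : R) (phi : R -> R).
Hypothesis tphi : test_function a b phi.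

Lemma test_function_derivable x : derivable phi x 1.
Proof. by case: tphi => /(_ 0%N). Qed.

Lemma test_function_continuous : continuous phi.
Proof.
move=> x; apply/differentiable_continuous/derivable1_diffP.
exact: test_function_derivable.
Qed.

(** Off its closed support [phi] is zero near each point, so its derivative is zero there and the
    support does not grow. *)
Lemma test_function_derive1 : test_function a b (derive1 phi).
Proof.
case: tphi => phiD phiK phiS.
have supp : closure [set x | derive1 phi x != 0] `<=` closure [set x | phi x != 0].
  rewrite [X in _ `<=` X](closure_id _).1; last exact: closed_closure.
  apply: closureS => x /= /eqP phix; apply: contrapT => xS; apply: phix.
  rewrite derive1E -(@derive_cst R R R 0 x 1); apply: near_eq_derive.
  have : nbhs x (~` closure [set x | phi x != 0]).
    apply: open_nbhs_nbhs; split => //; apply: closed_openC.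
    exact: closed_closure.
  apply: filterS => y yS; apply/eqP; apply/negP => /negP h; apply: yS.
  exact: subset_closure.
split.
- by move=> n x; rewrite -derive1Sn.
- exact: (subclosed_compact (@closed_closure _ _) phiK supp).
- exact: subset_trans phiS.
Qed.

End TestFunctions.

(** * Lebesgue integrals over intervals *)

Section IntegralTools.
Context {R : realType}.
Notation mu := (@lebesgue_measure R).
Implicit Types (f g k : R -> R) (a b c d m x : R).

Lemma ae_imply (P Q : R -> Prop) : (forall x, P x -> Q x) ->
  {ae mu, forall x, P x} -> {ae mu, forall x, Q x}.
Proof.
by move=> PQ; apply: filterS => //; exact: (ae_filter_ringOfSetsType mu).
Qed.

Lemma ae_imply2 (P Q S : R -> Prop) : (forall x, P x -> Q x -> S x) ->
  {ae mu, forall x, P x} -> {ae mu, forall x, Q x} -> {ae mu, forall x, S x}.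
Proof.
by move=> PQS; apply: filterS2 => //; exact: (ae_filter_ringOfSetsType mu).
Qed.

Lemma integrable_mul_continuous f k a b :
  mu.-integrable `[a, b] (EFin \o f) -> continuous k ->
  mu.-integrable `[a, b] (EFin \o (fun x => f x * k x)).
Proof.
move=> fi kc; apply: (integrableMl _ fi) => //.
  by apply: measurable_funTS; exact: continuous_measurable_fun.
have kc' : {within `[a, b], continuous k} by exact: continuous_subspaceT.
have /compact_bounded[M [_ mrt]] := continuous_compact kc' (@segment_compact _ a b).
by exists M; split; rewrite ?num_real // => ? ? ? ?; exact: mrt.
Qed.

Lemma integrable_itvS f a b c d : a <= c -> d <= b ->
  mu.-integrable `[a, b] (EFin \o f) -> mu.-integrable `[c, d] (EFin \o f).
Proof.
move=> ac db; apply: integrableS => //.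
by apply: subset_itv; rewrite bnd_simp.
Qed.

Lemma ae_eq_Rintegral_itv f g a b : mu.-integrable `[a, b] (EFin \o f) ->
  mu.-integrable `[a, b] (EFin \o g) ->
  {ae mu, forall x, x \in `]a, b[ -> f x = g x} ->
  \int[mu]_(x in `[a, b]) f x = \int[mu]_(x in `[a, b]) g x.
Proof.
move=> fi gi fg.
have sub : (`]a, b[%classic `<=` `[a, b]%classic).
  by apply: subset_itv; rewrite bnd_simp.
have mf : measurable_fun `]a, b[ (EFin \o f).
  exact: (measurable_funS _ sub (measurable_int mu fi)).
have mg : measurable_fun `]a, b[ (EFin \o g).
  exact: (measurable_funS _ sub (measurable_int mu gi)).
rewrite /Rintegral (@integral_itv_bndoo _ _ _ (EFin \o f))//.
rewrite (@integral_itv_bndoo _ _ _ (EFin \o g))//; congr fine.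
apply: ae_eq_integral => //.
by apply: ae_imply fg => x fg xab /=; rewrite fg.
Qed.

Lemma Rintegral_itv_split f a m b : a <= m -> m <= b ->
  mu.-integrable `[a, b] (EFin \o f) ->
  \int[mu]_(x in `[a, b]) f x =
  \int[mu]_(x in `[a, m]) f x + \int[mu]_(x in `[m, b]) f x.
Proof.
move=> am mb fi.
rewrite -[X in _ + X]Rintegral_itv_obnd_cbnd; last first.
  by apply: integrableS fi => //; apply: subset_itv; rewrite bnd_simp.
rewrite -(@Rintegral_itvB _ _ (BLeft a) (BRight b) m)// ?bnd_simp//.
by rewrite addrC subrK.
Qed.

Lemma Rintegral_support f (A B : set R) : A `<=` B ->
  (forall x, ~ A x -> f x = 0) ->
  \int[mu]_(x in B) f x = \int[mu]_(x in A) f x.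
Proof.
move=> AB f0; rewrite Rintegral_mkcond [RHS]Rintegral_mkcond.
apply: eq_Rintegral => x _; rewrite !patchE.
case: ifPn => xB; case: ifPn => xA //.
  by move: xA; rewrite notin_setE => /f0.
by move: xB; rewrite notin_setE; case; apply: AB; exact: set_mem.
Qed.

(** By Lebesgue differentiation an integrable function is a.e. the derivative of its primitive, here
    zero on each compact subinterval. *)
Lemma ae_eq0_of_integral_itv f c d :
  (forall a b, c < a -> a < b -> b < d ->
    mu.-integrable `[a, b] (EFin \o f) /\ \int[mu]_(x in `[a, b]) f x = 0) ->
  {ae mu, forall x, x \in `]c, d[ -> f x = 0}.
Proof.
move=> f0.
have f0_itv a b : c < a -> a < b -> b < d ->
    {ae mu, forall x, x \in `[a, b] -> f x = 0}.
  move=> ca ab bd; have [fi _] := f0 _ _ ca ab bd.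
  (* Extension by 0 allows a primitive from $-\infty$; its value at [x > a] is the integral of [f]
     over [[a, min(x, b)]]. *)
  pose g := f \_ `[a, b].
  have gi : mu.-integrable setT (EFin \o g).
    by rewrite -restrict_EFin; apply/integrable_restrict => //; rewrite setTI.
  have gNy y : mu.-integrable `]-oo, y] (EFin \o g) by exact: integrableS gi.
  have F0 : (fun x => \int[mu]_(t in `]-oo, x]) g t) = cst 0.
    apply/funext => x /=; rewrite -Rintegral_mkcondr.
    have [xa|ax] := leP x a.
      rewrite /Rintegral (integral_Sset1 a)// => y [] /=; rewrite !in_itv/=.
      move=> yx /andP[ay _]; apply/eqP; rewrite eq_le ay andbT.
      exact: le_trans xa.
    have -> : `]-oo, x] `&` `[a, b] = `[a, Num.min x b]%classic.
      apply/seteqP; split => y /=; rewrite !in_itv/= le_min.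
        by case=> -> /andP[-> ->].
      by case/and3P => -> -> ->.
    by apply: (f0 a _ ca _ _).2; rewrite ?lt_min ?ax// gt_min bd orbT.
  have gl := open_integrable_locally openT gi.
  have := FTC1Ny gNy gl; rewrite F0; apply: ae_imply => x [_ gx] xab.
  have : g x = 0 by rewrite -gx derive1_cst.
  by rewrite /g patchE mem_set.
(* Countably many subintervals exhaust []c, d[], so their exceptional sets have a null union. *)
have : {ae mu, forall x, forall n : nat,
    x \in `]c + n.+1%:R^-1, d - n.+1%:R^-1[ -> f x = 0}.
  apply: ae_foralln => n.
  have [h|h] := ltP (c + n.+1%:R^-1) (d - n.+1%:R^-1).
    have : {ae mu, forall x, x \in `[c + n.+1%:R^-1, d - n.+1%:R^-1] -> f x = 0}.
      by apply: f0_itv => //; rewrite ?ltrDl ?ltrBlDr ?ltrDl invr_gt0.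
    by apply: ae_imply => x fx xcd; apply: fx; exact: subset_itv_oo_cc xcd.
  by apply: aeW => x; rewrite in_itv/= => /andP[cx /(lt_trans cx)]; rewrite ltNge h.
apply: ae_imply => x fx; rewrite in_itv/= => /andP[cx xd].
have [n nE] : exists n : nat, n.+1%:R^-1 < Num.min (x - c) (d - x).
  have e0 : 0 < Num.min (x - c) (d - x) by rewrite lt_min !subr_gt0 cx.
  exists (Num.truncn (Num.min (x - c) (d - x))^-1).
  by rewrite invf_plt ?posrE// truncnS_gt.
move: nE; rewrite lt_min => /andP[n1 n2].
by apply: (fx n); rewrite in_itv/= -ltrBrDl n1 ltrBrDr -ltrBrDl n2.
Qed.

End IntegralTools.

(** * Weak derivatives of piecewise polynomials *)

Section WeakDerivative.
Context {R : realType}.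
Notation mu := (@lebesgue_measure R).
Implicit Types (f g w phi : R -> R) (q : {poly R}) (a b c d m x : R).

(** Dominated convergence: the bumps tend to the indicator of []a, b[] and are bounded by 1, so
    [|w|] dominates. *)
Lemma Rintegral_eq0_of_bump w a b : mu.-integrable `[a, b] (EFin \o w) ->
  (forall n : nat, \int[mu]_(x in `[a, b]) (w x * smooth_bump a b n.+1%:R x) = 0) ->
  \int[mu]_(x in `[a, b]) w x = 0.
Proof.
move=> wi w0.
have sub : (`]a, b[%classic `<=` `[a, b]%classic).
  by apply: subset_itv; rewrite bnd_simp.
have wi' : mu.-integrable `]a, b[ (EFin \o w) by exact: integrableS wi.
have bc n : continuous (smooth_bump a b n.+1%:R).
  (* On a larger open interval the bump is a test function, hence continuous. *)
  apply: (@test_function_continuous _ (a - 1) (b + 1)).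
  by apply: test_function_bump; rewrite ?ltr0n ?ltrDl ?gtrDl// oppr_lt0.
have wbi n : mu.-integrable `[a, b]
    (EFin \o (fun x => w x * smooth_bump a b n.+1%:R x)).
  exact: integrable_mul_continuous.
have mb n : measurable_fun `]a, b[
    (EFin \o (fun x => w x * smooth_bump a b n.+1%:R x)).
  exact: (measurable_funS _ sub (measurable_int mu (wbi n))).
have [||||_ _] := @dominated_convergence _ _ _ mu `]a, b[%classic
  (measurable_itv _) _ (EFin \o w) (abse \o (EFin \o w)) mb.
- exact: measurable_int wi'.
- apply: aeW => x /=; rewrite in_itv/= => xab.
  apply: cvg_EFin; first by near=> n.
  rewrite -[X in _ --> X]mulr1; apply: cvgMl_tmp.
  by have := @bump_cvg R a b x; rewrite xab.
- exact: integrable_abse.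
- apply: aeW => x n xab /=; rewrite lee_fin normrM -[leRHS]mulr1.
  by rewrite ler_wpM2l// bump_norm_le1.
have -> : [sequence (\int[mu]_(x in `]a, b[)
    (w x * smooth_bump a b n.+1%:R x)%:E)%E]_n = cst 0%E.
  apply/funext => n /=; have := w0 n; rewrite /Rintegral.
  rewrite (@integral_itv_bndoo _ _ _ (EFin \o _))//.
  move=> H; rewrite -[LHS]fineK ?H//; apply: integrable_fin_num => //.
  exact: integrableS (wbi n).
move=> /(cvg_lim (@ereal_hausdorff R)); rewrite lim_cst// => w0'.
rewrite /Rintegral (@integral_itv_bndoo _ _ _ (EFin \o w))//.
  by rewrite -w0'.
exact: measurable_int wi'.
Unshelve. all: by end_near. Qed.

Lemma locally_integrable_itv f a b c d : a < c -> d < b ->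
  locally_integrable `]a, b[ f -> mu.-integrable `[c, d] (EFin \o f).
Proof.
move=> ac db [mf _ fi].
have sub : `[c, d]%classic `<=` `]a, b[%classic.
  by apply: subset_itv; rewrite bnd_simp.
apply/integrableP; split; last by apply: fi => //; exact: segment_compact.
by apply/measurable_EFinP; exact: measurable_funS mf.
Qed.

Lemma weak_derivative1P f g phi a b : weak_derivative a b 1 f g ->
  test_function a b phi ->
  \int[mu]_(x in `]a, b[) (f x * derive1 phi x) =
  - \int[mu]_(x in `]a, b[) (g x * phi x).
Proof.
move=> [_ _ fg] /fg; rewrite /Rintegral expr1 => ->.
by rewrite EFinN mulN1e fineN.
Qed.

Lemma derive1_support phi c d :
  (forall x, x \notin `[c, d] -> phi x = 0) ->
  forall x, x \notin `[c, d] -> derive1 phi x = 0.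
Proof.
move=> phi0 x xcd; rewrite derive1E -(@derive_cst R R R 0 x 1).
apply: near_eq_derive.
have : nbhs x (~` `[c, d]%classic).
  apply: open_nbhs_nbhs; split; last exact/negP.
  exact/closed_openC/itv_closed.
by apply: filterS => y /negP; exact: phi0.
Qed.

Lemma test_function_by_parts q phi a b c d : c < d -> test_function a b phi ->
  \int[mu]_(x in `[c, d]) (q.[x] * derive1 phi x) =
  q.[d] * phi d - q.[c] * phi c - \int[mu]_(x in `[c, d]) (q^`()%R.[x] * phi x).
Proof.
move=> cd tphi; apply: (@Rintegration_by_parts R (horner q) phi) => //.
- exact/continuous_subspaceT/continuous_horner.
- split.
  + by move=> x _; exact: derivable_horner.
  + exact/cvg_at_right_filter/continuous_horner.
  + exact/cvg_at_left_filter/continuous_horner.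
- by move=> x _; rewrite -derivE.
- apply: continuous_subspaceT.
  exact: test_function_continuous (test_function_derive1 tphi).
- split.
  + by move=> x _; exact: test_function_derivable tphi _.
  + exact/cvg_at_right_filter/(test_function_continuous tphi).
  + exact/cvg_at_left_filter/(test_function_continuous tphi).
Qed.

(** Integrating [f * phi'] by parts on each piece, the boundary terms at [c] and [d] vanish with
    [phi], and those at [m] leave the jump. *)
Lemma weak_derivative_piecewise f g q1 q2 phi a b c m d :
  weak_derivative a b 1 f g -> a < c -> c < m -> m < d -> d < b ->
  {ae mu, forall x, x \in `]c, m[ -> f x = q1.[x]} ->
  {ae mu, forall x, x \in `]m, d[ -> f x = q2.[x]} ->
  test_function a b phi -> (forall x, ~~ (c < x < d) -> phi x = 0) ->
  \int[mu]_(x in `[c, d]) (g x * phi x) =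
  \int[mu]_(x in `[c, m]) (q1^`()%R.[x] * phi x) +
  \int[mu]_(x in `[m, d]) (q2^`()%R.[x] * phi x) - (q1.[m] - q2.[m]) * phi m.
Proof.
move=> fg ac cm md db fq1 fq2 tphi phi0.
have [fl gl _] := fg.
have phi_cd x : x \notin `[c, d] -> phi x = 0.
  rewrite in_itv/= => xcd; apply: phi0; apply: contra xcd.
  by move=> /andP[/ltW -> /ltW ->].
have dphi_cd := derive1_support phi_cd.
have sub : `[c, d]%classic `<=` `]a, b[%classic.
  by apply: subset_itv; rewrite bnd_simp.
have := weak_derivative1P fg tphi.
rewrite !(Rintegral_support sub); first last.
- by move=> x /negP /dphi_cd ->; rewrite mulr0.
- by move=> x /negP /phi_cd ->; rewrite mulr0.
have dphic := test_function_continuous (test_function_derive1 tphi).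
have fi : mu.-integrable `[c, d] (EFin \o f) by exact: locally_integrable_itv fl.
rewrite (@Rintegral_itv_split _ _ _ m) ?(ltW cm) ?(ltW md)//; last first.
  exact: integrable_mul_continuous.
have piece q u v : c <= u -> v <= d ->
    {ae mu, forall x, x \in `]u, v[ -> f x = q.[x]} ->
    \int[mu]_(x in `[u, v]) (f x * derive1 phi x) =
    \int[mu]_(x in `[u, v]) (q.[x] * derive1 phi x).
  move=> cu vd fq; apply: ae_eq_Rintegral_itv.
  - by apply: integrable_mul_continuous => //; exact: integrable_itvS fi.
  - by apply: integrable_mul_continuous => //; exact: integrable_horner.
  - by apply: ae_imply fq => x fq /fq ->.
rewrite (piece q1)// ?ltW// (piece q2)// ?ltW//.
rewrite !(test_function_by_parts _ _ tphi)//.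
rewrite (phi0 c) ?ltxx// (phi0 d) ?ltxx ?andbF// !mulr0.
by move=> H; apply: oppr_inj; rewrite -H; ring.
Qed.

(** With the same polynomial on both pieces there is no jump, so [g - q'] integrates to 0 against
    all bumps, hence over all compact subintervals. *)
Lemma weak_derivative_poly f g q a b c d : weak_derivative a b 1 f g ->
  a <= c -> d <= b ->
  {ae mu, forall x, x \in `]c, d[ -> f x = q.[x]} ->
  {ae mu, forall x, x \in `]c, d[ -> g x = q^`()%R.[x]}.
Proof.
move=> fg ac db fq.
suff : {ae mu, forall x, x \in `]c, d[ -> g x - q^`()%R.[x] = 0}.
  by apply: ae_imply => x H /H /eqP; rewrite subr_eq0 => /eqP.
apply: ae_eq0_of_integral_itv => u v cu uv vd.
have au := le_lt_trans ac cu; have vb := lt_le_trans vd db.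
have [_ gl _] := fg.
have gi : mu.-integrable `[u, v] (EFin \o g) by exact: locally_integrable_itv gl.
have qi := integrable_horner q^`()%R u v.
have wi : mu.-integrable `[u, v] (EFin \o (fun x => g x - q^`()%R.[x])).
  have : mu.-integrable `[u, v] ((EFin \o g) \- (EFin \o horner q^`()%R))%E.
    exact: integrableB.
  exact: eq_integrable.
split => //; apply: Rintegral_eq0_of_bump => // n.
pose m := (u + v) / 2; have um : u < m by rewrite /m; lra.
have mv : m < v by rewrite /m; lra.
have tb : test_function a b (smooth_bump u v n.+1%:R) by exact: test_function_bump.
have bc := test_function_continuous tb.
have subq : {ae mu, forall x, x \in `]u, v[ -> f x = q.[x]}.
  apply: ae_imply fq => x fq /=; rewrite in_itv/= => /andP[ux xv]; apply: fq.
  by rewrite in_itv/= (lt_trans cu)// (lt_trans xv).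
have := @weak_derivative_piecewise f g q q (smooth_bump u v n.+1%:R) a b u m v.
rewrite subrr mul0r subr0 -Rintegral_itv_split ?ltW//; last first.
  exact: integrable_mul_continuous.
move=> H.
under eq_Rintegral do rewrite mulrBl.
rewrite RintegralB//; [|exact: integrable_mul_continuous..].
apply/eqP; rewrite subr_eq0; apply/eqP; apply: H => //.
- apply: ae_imply subq => x fx; rewrite in_itv/= => /andP[ux xm]; apply: fx.
  by rewrite in_itv/= ux (lt_trans xm).
- apply: ae_imply subq => x fx; rewrite in_itv/= => /andP[mx xv]; apply: fx.
  by rewrite in_itv/= xv (lt_trans um).
- by move=> x; exact: bump_eq0.
Qed.

(* A jump at [m] would contribute a Dirac mass to the derivative. *)
Lemma weak_derivative_glue f g q1 q2 a b c m d : weak_derivative a b 1 f g ->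
  a <= c -> c < m -> m < d -> d <= b ->
  {ae mu, forall x, x \in `]c, m[ -> f x = q1.[x]} ->
  {ae mu, forall x, x \in `]m, d[ -> f x = q2.[x]} ->
  q1.[m] = q2.[m].
Proof.
move=> fg ac cm md db fq1 fq2.
have mb : m <= b by rewrite (le_trans (ltW md)).
have am : a <= m by rewrite (le_trans ac)// ltW.
have gq1 := weak_derivative_poly fg ac mb fq1.
have gq2 := weak_derivative_poly fg am db fq2.
(* Shrinking to [[u, v]] keeps the bump compactly supported in []a, b[] even when [c = a] or
   [d = b]. *)
pose u := (c + m) / 2; pose v := (m + d) / 2.
have cu : c < u by rewrite /u; lra.
have um : u < m by rewrite /u; lra.
have mv : m < v by rewrite /v; lra.
have vd : v < d by rewrite /v; lra.
have au := le_lt_trans ac cu; have vb := lt_le_trans vd db.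
have tb : test_function a b (smooth_bump u v 1) by exact: test_function_bump.
have bc := test_function_continuous tb.
have subl h q : {ae mu, forall x, x \in `]c, m[ -> h x = q.[x]} ->
    {ae mu, forall x, x \in `]u, m[ -> h x = q.[x]}.
  apply: ae_imply => x hq; rewrite in_itv/= => /andP[ux xm]; apply: hq.
  by rewrite in_itv/= xm (lt_trans cu).
have subr h q : {ae mu, forall x, x \in `]m, d[ -> h x = q.[x]} ->
    {ae mu, forall x, x \in `]m, v[ -> h x = q.[x]}.
  apply: ae_imply => x hq; rewrite in_itv/= => /andP[mx xv]; apply: hq.
  by rewrite in_itv/= mx (lt_trans xv).
have [_ gl _] := fg.
have gi : mu.-integrable `[u, v] (EFin \o g) by exact: locally_integrable_itv gl.
have := weak_derivative_piecewise fg au um mv vb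
  (subl _ _ fq1) (subr _ _ fq2) tb.
rewrite (@Rintegral_itv_split _ _ _ m) ?(ltW um) ?(ltW mv)//; last first.
  exact: integrable_mul_continuous.
have piece q s t : u <= s -> t <= v ->
    {ae mu, forall x, x \in `]s, t[ -> g x = q.[x]} ->
    \int[mu]_(x in `[s, t]) (g x * smooth_bump u v 1 x) =
    \int[mu]_(x in `[s, t]) (q.[x] * smooth_bump u v 1 x).
  move=> us tv gq; apply: ae_eq_Rintegral_itv.
  - by apply: integrable_mul_continuous => //; exact: integrable_itvS gi.
  - by apply: integrable_mul_continuous => //; exact: integrable_horner.
  - by apply: ae_imply gq => x gq /gq ->.
rewrite (piece q1^`()%R) ?(ltW mv)//; last exact: subl.
rewrite (piece q2^`()%R) ?(ltW um)//; last exact: subr.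
have b0 x : ~~ (u < x < v) -> smooth_bump u v 1 x = 0 by exact: bump_eq0.
(* The integrals cancel, leaving the jump times the positive value of the bump at [m]. *)
move=> /(_ b0) /eqP; rewrite -subr_eq0 opprB addrC subrK mulf_eq0 subr_eq0.
by rewrite [X in _ || X]gt_eqF ?bump_gt0 ?um// orbF => /eqP.
Qed.

(** The identity of order [k] tested with [phi'] is compared with that of order [k.+1] tested with
    [phi]; the common sign $(-1)^k$ cancels. *)
Lemma weak_derivative_succ k f g w a b : weak_derivative a b k f g ->
  weak_derivative a b k.+1 f w -> weak_derivative a b 1 g w.
Proof.
move=> [fl gl fg] [_ wl fw]; split => // phi tphi.
have := fw _ tphi; rewrite derive1Sn (fg _ (test_function_derive1 tphi)).
rewrite exprS mulN1r => H.
move/(congr1 (fun y : \bar R => ((-1) ^+ k)%:E * y)%E): H.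
rewrite !muleA -!EFinM -!expr2 sqrr_sign mul1e => ->.
by rewrite mulrN -expr2 sqrr_sign.
Qed.

Lemma weak_derivative0 f a b : locally_integrable `]a, b[ f ->
  weak_derivative a b 0 f f.
Proof. by move=> fl; split => // phi _; rewrite expr0 mul1e. Qed.

End WeakDerivative.

(** * Traces and $L^2$ norms of piecewise polynomials *)

Section Splines.
Context {R : realType}.
Notation mu := (@lebesgue_measure R).
Implicit Types (f g u : R -> R) (q : {poly R}) (a b c d h x : R).

Lemma ae_itv_exists (P : R -> Prop) c d : c < d -> {ae mu, forall x, P x} ->
  exists2 x, x \in `]c, d[ & P x.
Proof.
move=> cd [N [mN N0 PN]]; apply: contrapT => noP.
have sub : `]c, d[%classic `<=` N.
  by move=> x xcd; apply: PN => Px; apply: noP; exists x.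
have : (mu `]c, d[%classic <= 0)%E by rewrite -N0 le_measure// inE.
by rewrite lebesgue_measure_itv/= lte_fin cd -EFinB lee_fin subr_le0 leNgt cd.
Qed.

(** If the values at [x] differed, so would those at all nearby points of [[a, b]]; these meet []c,
    d[] in an interval of positive measure, even when [x] is [c] or [d]. *)
Lemma continuous_ae_eq f g a b c d x : {within `[a, b], continuous f} ->
  {within `[a, b], continuous g} -> a <= c -> c < d -> d <= b ->
  {ae mu, forall y, y \in `]c, d[ -> f y = g y} ->
  c <= x <= d -> f x = g x.
Proof.
move=> fc gc ac cd db fg /andP[cx xd].
have xab : `[a, b]%classic x by rewrite /= in_itv/= (le_trans ac)// (le_trans xd).
have kx : (fun y => f y - g y) @ within `[a, b]%classic (nbhs x) --> f x - g x.
  apply: cvgB.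
    by move/subspace_continuousP : fc; exact.
  by move/subspace_continuousP : gc; exact.
apply/eqP; rewrite -subr_eq0; apply/negP => /negP k0.
have := cvgr_neq0 _ kx k0; rewrite near_withinE => -[e /= e0 He].
have lt_e : Num.max c (x - e) < Num.min d (x + e).
  by rewrite lt_min !gt_max cd; apply/and3P; split; lra.
have [y + fgy] := ae_itv_exists lt_e fg.
rewrite in_itv/= gt_max lt_min => /andP[/andP[cy xy] /andP[yd yx]].
have : f y - g y != 0.
  apply: He; first by rewrite /ball/= ltr_norml; lra.
  by rewrite /= in_itv/= (le_trans ac (ltW cy)) (le_trans (ltW yd)).
by rewrite fgy ?subrr ?eqxx// in_itv/= cy.
Qed.

(** This turns the boundary conditions on traces into conditions on the polynomials of the end
    cells. *)
Lemma trace_poly f q a b c d x y : trace a b f x y ->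
  a <= c -> c < d -> d <= b ->
  {ae mu, forall z, z \in `]c, d[ -> f z = q.[z]} ->
  c <= x <= d -> q.[x] = y.
Proof.
move=> [g [gc fg <-]] ac cd db fq xcd; apply/esym.
apply: (continuous_ae_eq gc _ ac cd db _ xcd).
  exact/continuous_subspaceT/continuous_horner.
apply: ae_imply2 fg fq => z + + zcd => <- ; first exact.
move: zcd; rewrite !in_itv/= => /andP[cz zd].
by rewrite (le_lt_trans ac)// (lt_le_trans zd).
Qed.

(** The integral of the square is accumulated over half-open cells from the left; endpoints are
    null. *)
Lemma L2norm_piecewise f a b n (t : nat -> R) (Q : nat -> {poly R}) :
  measurable_fun `]a, b[ f -> (forall j, t j < t j.+1) -> t 0 = a -> t n = b ->
  (forall j, (j < n)%N ->
    {ae mu, forall x, x \in `]t j, t j.+1[ -> f x = (Q j).[x]}) ->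
  L2norm a b f = (Num.sqrt (broken n t Q Q))%:E.
Proof.
move=> mf t_incr t0 tn fQ.
have t_le : {homo t : i j / (i <= j)%N >-> i <= j}.
  by apply: homo_leq => [x|y x z|i]; [exact: lexx|exact: le_trans|exact: ltW].
pose F x := ((restr a b f x) ^+ 2)%:E.
have mr : measurable_fun setT (restr a b f) by exact/(measurable_restrictT _ _).1.
have mF : measurable_fun setT F.
  by apply/measurable_EFinP; exact: measurable_funX.
have F0 x : (0%R%:E <= F x)%E by rewrite lee_fin sqr_ge0.
have mq q (D : set R) : measurable_fun D (EFin \o horner q).
  apply: measurable_funTS; apply/measurable_EFinP.
  by apply: continuous_measurable_fun; exact: continuous_horner.
have cells j : (j <= n)%N -> (\int[mu]_(x in `[t 0%N, t j[) F x)%E =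
    (broken j t Q Q)%:E.
  elim: j => [_|j IH jn].
    by rewrite set_itvco0 integral_set0 /broken big_ord0.
  rewrite (@itv_bndbnd_setU _ _ _ (BLeft (t j))) ?bnd_simp ?t_le//.
  rewrite ge0_integral_setU//; last 2 first.
  - exact: measurable_funTS.
  - rewrite disj_set2E; apply/eqP/seteqP; split => // x [] /=.
    by rewrite !in_itv/= => /andP[_ xt] /andP[tx _]; move: xt; rewrite ltNge tx.
  rewrite IH 1?ltnW// /broken big_ord_recr EFinD; congr (_ + _)%E.
  rewrite integral_itv_bndoo; last exact: measurable_funTS.
  rewrite -integral_pint (@integral_itv_bndoo _ _ _ (EFin \o horner _));
    last exact: mq.
  apply: ae_eq_integral => //; [exact: measurable_funTS|exact: mq|].
  apply: ae_imply (fQ _ jn) => x fx xt; rewrite /F /restr patchE mem_set.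
    by rewrite fx//= hornerM expr2.
  move: xt; rewrite /= !in_itv/= => /andP[tx xt].
  by rewrite -t0 -tn (le_lt_trans _ tx) ?t_le// (lt_le_trans xt) ?t_le.
rewrite /L2norm Lnorm.unlock.
have -> : (\int[mu]_x (`|(EFin \o restr a b f) x| `^ 2) = (broken n t Q Q)%:E)%E.
  rewrite -cells// integral_mkcond [RHS]integral_mkcond.
  apply: eq_integral => x _.
  rewrite patch_setT patchE; case: ifPn => [_|].
    by rewrite /F /= -[_ ^+ 2]real_normK ?num_real// powR_mulrn.
  rewrite notin_setE/= in_itv/= t0 tn => xab.
  rewrite /= /restr patchE ifF ?normr0 ?powR0//.
  apply/negP; rewrite inE/= in_itv/= => /andP[/ltW ax xb]; apply: xab.
  by rewrite ax.
by rewrite poweR_EFin powR12_sqrt// broken_sqr_ge0.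
Qed.

End Splines.

(** * The inverse inequality for splines with vanishing odd derivatives *)

Theorem theorem4 (R : realType) (a b : R) (hab : a < b)
    (h : R) (hh : grid_size a b h) (p : nat) (hp : (0 < p)%N)
    (u : R -> R) (hu : spline_odd a b p h u) :
  (Hseminorm a b 1 u <= (2 * Num.sqrt 3 * h^-1)%:E * L2norm a b u)%E.
Proof.
case: hh => h0 [n n0 nE]; case: hu => -[[_ uH] uQ] uodd.
have cellsE : ncells a b h = n by rewrite /ncells nE natrK.
pose t j : R := a + h * j%:R.
have tS j : t j.+1 = t j + h by rewrite /t -natr1; ring.
have t_incr j : t j < t j.+1 by rewrite tS ltrDl.
have t_le : {homo t : i j / (i <= j)%N >-> i <= j}.
  by apply: homo_leq => [x|y x z|i]; [exact: lexx|exact: le_trans|exact: ltW].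
have ta : t 0 = a by rewrite /t mulr0 addr0.
have tb : t n = b by rewrite /t -nE mulVKf ?gt_eqF//; ring.
have ta_le j : a <= t j by rewrite -ta t_le.
have t_le_b j : (j < n)%N -> t j.+1 <= b by move=> jn; rewrite -tb t_le.
have [Q sQ uQ'] : exists2 Q : nat -> {poly R},
    forall j, (j < n)%N -> (size (Q j) <= p.+1)%N &
    forall j, (j < n)%N -> {ae lebesgue_measure,
      forall x, x \in `]t j, t j.+1[ -> u x = (Q j).[x]}.
  (* The form needed for [choice]; beyond the last cell the polynomial is 0 by default. *)
  have : forall j, exists q : {poly R}, (j < n)%N -> (size q <= p.+1)%N /\
      {ae lebesgue_measure, forall x, x \in `]t j, t j.+1[ -> u x = q.[x]}.
    move=> j; have [jn|] := ltnP j n; last by exists 0.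
    have [|q sq uq] := uQ j; first by rewrite cellsE.
    exists q => _; split => //; apply: ae_imply uq => x uq xt; apply: uq.
    exact: subset_itv_oo_oc xt.
  by move=> /choice[Q HQ]; exists Q => j /HQ[].
(* Order 0 is [u] itself, whereas [wderiv] only picks some representative. *)
pose W k := if k is 0 then u else wderiv a b k u.
have uW k : (k <= p)%N -> weak_derivative a b k u (W k).
  case: k => [_|k kp].
    (* Local integrability of [u] is part of having a first weak derivative, which exists as [p] is
       positive. *)
    by apply: weak_derivative0; have [v [? _ _] _] := uH 1%N hp.
  have [|v uv _] := uH k.+1; first by rewrite kp.
  exact: (@xgetPex _ (fun=> 0) [set v | weak_derivative a b k.+1 u v]
    (ex_intro _ v uv)).
have WS k : (k < p)%N -> weak_derivative a b 1 (W k) (W k.+1).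
  by move=> kp; apply: weak_derivative_succ (uW _ kp); apply: uW; exact: ltnW.
have WQ k j : (k <= p)%N -> (j < n)%N -> {ae lebesgue_measure,
    forall x, x \in `]t j, t j.+1[ -> W k x = (derivn k (Q j)).[x]}.
  move=> + jn; elim: k => [_|k IH kp]; first exact: uQ'.
  rewrite derivnS.
  exact: (weak_derivative_poly (WS _ kp) (ta_le j) (t_le_b _ jn)
    (IH (ltnW kp))).
have mW k : (k <= p)%N -> measurable_fun `]a, b[ (W k) by move=> /uW[_ []].
have main : broken n t (fun j => derivn 1 (Q j)) (fun j => derivn 1 (Q j)) <=
    12 * h^-1 ^+ 2 * broken n t Q Q.
  apply: (broken_inverse_inequality t_incr h0 n0 hp tS sQ) =>
    [k j kp jn|k kp ok].
    exact: (weak_derivative_glue (WS _ kp) (ta_le j) (t_incr j) (t_incr j.+1)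
      (t_le_b _ jn) (WQ _ _ (ltnW kp) (ltnW jn)) (WQ _ _ (ltnW kp) jn)).
  (* The boundary conditions are indexed by [l] with [k = 2 l + 1]. *)
  have kE : k = k./2.*2.+1 by rewrite -{1}(odd_double_half k) ok.
  have [] := uodd k./2; first by rewrite -kE.
  rewrite -kE => tra trb; have WE : W k = wderiv a b k u by rewrite kE.
  rewrite -{}WE in tra trb; have n1 : (n.-1 < n)%N by rewrite prednK.
  rewrite ta tb; split.
    apply: (trace_poly tra (ta_le 0%N) (t_incr 0%N) (t_le_b _ n0)
      (WQ _ _ (ltnW kp) n0)).
    by rewrite ta lexx -ta ltW.
  apply: (trace_poly trb (ta_le _) (t_incr _) (t_le_b _ n1)
    (WQ _ _ (ltnW kp) n1)).
  by rewrite prednK// tb lexx andbT -tb t_le// leq_pred.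
rewrite /Hseminorm (L2norm_piecewise (mW _ hp) t_incr ta tb (WQ 1%N ^~ hp)).
rewrite (L2norm_piecewise (mW 0%N isT) t_incr ta tb (WQ 0%N ^~ isT)).
rewrite -EFinM lee_fin.
have h'0 : 0 <= 2 * h^-1 by rewrite mulr_ge0// invr_ge0 ltW.
have -> : 2 * Num.sqrt 3 * h^-1 = Num.sqrt (12 * h^-1 ^+ 2).
  have -> : 12 * h^-1 ^+ 2 = 3 * (2 * h^-1) ^+ 2 by ring.
  by rewrite sqrtrM// sqrtr_sqr ger0_norm//; ring.
by rewrite -sqrtrM ?ler_wsqrtr// mulr_ge0// sqr_ge0.
Qed.
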